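(* Let $f:\mathbb{R}\to\mathbb{R}$ be a function with the Baire property. If $f$ is $(S,T)$ shift continuous for some set $S\subset\mathbb{R}$ with the Baire property and some (arbitrary) set $T\subset\mathbb{R}$, then $f$ is continuous at every point of $\mathrm{BD}(S)+\mathrm{SC}(T)$.
   Context: Shift continuity: for sets $S,T\subset\mathbb{R}$, a function $f:\mathbb{R}\to\mathbb{R}$ is called $(S,T)$ shift continuous if there exists a second countable topology $\mathcal{T}$ on the set $T$ such that for every $s_0\in S$ the function $T\to\mathbb{R}$, $t\mapsto f(s_0+t)$, is continuous with respect to $\mathcal{T}$. A set is of first category if it is a countable union of nowhere dense sets, and of second category otherwise. A function has the Baire property if preimages of open sets have the Baire property. $\mathrm{BD}(S)$ is the set of Baire density points of $S$: all $x\in\mathbb{R}$ (possibly outside $S$) for which there is an open set $U\ni x$ with $U\setminus S$ of first category. $\mathrm{SC}(T)$ is the set of second category points of $T$: all $x\in\mathbb{R}$ (possibly outside $T$) such that for every open $U\ni x$ the set $T\cap U$ is of second category. $A+B=\{a+b : a\in A,\ b\in B\}$. *)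

(* Defs.v *)
(* The real line is an arbitrary [R : realType] with its usual topology. *)
From HB Require Import structures.
From mathcomp Require Import all_boot all_order all_algebra.
From mathcomp Require Import all_classical all_reals.
From mathcomp Require Import topology normedtype.

Set Implicit Arguments.
Unset Strict Implicit.
Unset Printing Implicit Defensive.

Import Order.TTheory GRing.Theory Num.Theory.
Import numFieldNormedType.Exports.

Local Open Scope classical_set_scope.
Local Open Scope ring_scope.

Definition nowhere_dense (X : topologicalType) (A : set X) : Prop :=
  interior (closure A) = set0.

Definition first_category (X : topologicalType) (A : set X) : Prop :=
  exists2 F : nat -> set X, (forall n, nowhere_dense (F n)) &
    A = \bigcup_n F n.

Definition second_category (X : topologicalType) (A : set X) : Prop :=
  ~ first_category A.

(* [A `+` U] is the symmetric difference. *)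
Definition baire_set (X : topologicalType) (A : set X) : Prop :=
  exists2 U : set X, open U & first_category (A `+` U).

Definition baire_function (X Y : topologicalType) (f : X -> Y) : Prop :=
  forall V : set Y, open V -> baire_set (f @^-1` V).

(* [Topological T] is the type of topologies on the set T (seen as the type
   [set_type T]), without any relation to the topology induced by R.  Such a
   class also carries the choice structure that the library asks of every
   topological space; it plays no role and always exists, even when T is
   empty. *)
Definition shift_continuous (R : realType) (S T : set R) (f : R -> R) : Prop :=
  exists tau : Topological (set_type T),
    let X : topologicalType := Topological.Pack tau in
    @second_countable X /\
    forall s0 : R, S s0 -> continuous (fun t : X => f (s0 + set_val t)).

Definition BD (R : realType) (S : set R) : set R :=
  [set x | exists U : set R, [/\ open U, U x & first_category (U `\` S)]].

Definition SC (R : realType) (T : set R) : set R :=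
  [set x | forall U : set R, open U -> U x -> second_category (T `&` U)].

Definition sumset (R : realType) (A B : set R) : set R :=
  [set a + b | a in A & b in B].

(* Main.v *)
(* Fix [x] near [a + b] and [eps > 0].  For a nonmeager set of [t] in [T] the
   point [x - t] lies in [S], so [t' |-> f (x - t + t')] stays within [eps] of
   [f x] on a basic neighbourhood [B] of [t] in the topology of [T].  There are
   countably many [B], so a single [B] works for a nonmeager set [A] of [t],
   and [A] is everywhere nonmeager in some open [I].  For [t'] in [A] and [I],
   all points of [x + t' - A] have values within [eps] of [f x], and since [f]
   has the Baire property this forces
   [|f y - f x| <= eps] for all [y] outside a meager subset of the neighbourhood
   [x + t' - I] of [x].  Two such neighbourhoods that meet have, by the Baire
   category theorem, a common good point, whence continuity. *)
Require Import Defs.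
From mathcomp Require Import all_boot all_order all_algebra.
From mathcomp Require Import all_classical all_reals.
From mathcomp Require Import topology normedtype sequences.
From mathcomp Require Import lra.
Import Order.TTheory GRing.Theory Num.Theory.
Import numFieldNormedType.Exports.
Local Open Scope classical_set_scope.
Local Open Scope ring_scope.

(** * Sets of first category in a topological space *)

Lemma nowhere_dense_subset (X : topologicalType) (A B : set X) :
  A `<=` B -> nowhere_dense B -> nowhere_dense A.
Proof.
move=> AB nB; rewrite /nowhere_dense -subset0 -nB.
exact/interiorS/closureS.
Qed.

Lemma nowhere_dense0 (X : topologicalType) : nowhere_dense (@set0 X).
Proof. by rewrite /nowhere_dense closure0 interior0. Qed.

Lemma first_category_subset (X : topologicalType) (A B : set X) :
  A `<=` B -> first_category B -> first_category A.
Proof.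
move=> AB [F ndF BE]; exists (fun n => A `&` F n) => [n|].
  by apply: nowhere_dense_subset (ndF n) => x [].
by rewrite -setI_bigcupr -BE; apply/esym/setIidPl.
Qed.

Lemma nowhere_dense_first_category (X : topologicalType) (A : set X) :
  nowhere_dense A -> first_category A.
Proof.
by move=> ndA; exists (fun=> A) => //; rewrite bigcup_const//; exists 0%N.
Qed.

Lemma first_category_bigcup (X : topologicalType) (I : Type) (D : set I)
    (A : I -> set X) :
  countable D -> (forall i, D i -> first_category (A i)) ->
  first_category (\bigcup_(i in D) A i).
Proof.
move=> /pcard_injP[h hinj] fcA.
have /choice[F FP] : forall i, exists F : nat -> set X, D i ->
    (forall n, nowhere_dense (F n)) /\ A i = \bigcup_n F n.
  move=> i; have [/fcA[F ndF AE]|nDi] := pselect (D i); first by exists F.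
  by exists (fun=> set0).
(* A single sequence replaces the doubly indexed family: [G k] is [F i n] if [k] codes [(h i, n)]
   with [i] in [D], and empty if [k] codes no such pair. *)
pose G k := [set x | exists i (n : nat), [/\ D i, pickle (h i, n) = k & F i n x]].
apply: (@first_category_subset _ _ (\bigcup_k G k)) => [x [i Di]|].
  have [_ ->] := FP i Di; move=> [n _ Fx].
  by exists (pickle (h i, n)) => //; exists i, n.
exists G => // k.
have [ex|noi] := pselect (exists i (n : nat), D i /\ pickle (h i, n) = k).
  have [i [n [Di ik]]] := ex.
  have [ndF _] := FP i Di.
  apply: nowhere_dense_subset (ndF n) => x [j [m [Dj]]].
  rewrite -ik => /(pcan_inj pickleK)[hji ->].
  by rewrite (hinj j i) // inE.
suff -> : G k = set0 by exact: nowhere_dense0.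
by rewrite -subset0 => x [i [n [Di ik _]]]; apply: noi; exists i, n.
Qed.

Lemma first_categoryU (X : topologicalType) (A B : set X) :
  first_category A -> first_category B -> first_category (A `|` B).
Proof.
move=> fcA fcB; rewrite -bigcup2E.
apply: first_category_bigcup; first exact: countableP.
case=> [|[|n]] _ //=.
exact/nowhere_dense_first_category/nowhere_dense0.
Qed.

(** An involution is its own inverse, so continuity alone makes [g] a homeomorphism, which preserves
    closures and interiors. *)
Lemma first_category_preimage_involutive (X : topologicalType) (g : X -> X)
    (A : set X) :
  continuous g -> involutive g -> first_category A -> first_category (g @^-1` A).
Proof.
move=> cg gK [F ndF ->]; exists (fun n => g @^-1` F n) => [n|]; last first.
  by rewrite preimage_bigcup.
have clF : closure (g @^-1` F n) `<=` g @^-1` closure (F n).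
  move=> y cly V Vgy; have [z [Fz Vz]] := cly (g @^-1` V) (cg y V Vgy).
  by exists (g z).
rewrite /nowhere_dense -subset0 => x Fx.
suff : (closure (F n))° (g x) by rewrite ndF.
have : nbhs (g (g x)) (closure (g @^-1` F n)) by rewrite gK.
move=> /(cg (g x)); rewrite nbhs_simpl /=; apply: filterS => z /clF.
by rewrite /= gK.
Qed.

(* Removing from [A] its first category traces on basic open sets leaves a
   second category, hence somewhere dense, set; [I] is the interior of its
   closure. *)
Lemma second_category_localize (X : topologicalType) (A : set X) :
  @second_countable X -> second_category A ->
  exists I : set X, [/\ open I, A `&` I !=set0 &
    forall Q, open Q -> Q `<=` I -> Q !=set0 -> second_category (A `&` Q)].
Proof.
move=> [B cB [Bo Bb]] scA.
pose M := \bigcup_(V in B `&` [set V | first_category (A `&` V)]) (A `&` V).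
have fcM : first_category M.
  apply: first_category_bigcup => [|V []//].
  by apply: sub_countable cB; apply: subset_card_le => V [].
have /eqP/set0P[p Ip] : (closure (A `\` M))° <> set0.
  move=> ndAM; apply: scA.
  apply: (@first_category_subset _ _ ((A `\` M) `|` M)).
    by move=> x Ax; have [Mx|nMx] := pselect (M x); [right|left].
  by apply: first_categoryU => //; exact: nowhere_dense_first_category.
have Iopen : open (closure (A `\` M))° by exact: open_interior.
have meet Q : open Q -> Q `<=` (closure (A `\` M))° -> Q !=set0 ->
    (A `\` M) `&` Q !=set0.
  move=> Qo QI [q Qq]; apply: (interior_subset (QI _ Qq)).
  exact: open_nbhs_nbhs.
exists (closure (A `\` M))°; split => //.
  have [||c [[Ac _] Ic]] := meet _ Iopen; [by []|by exists p|by exists c].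
move=> Q Qo QI Q0 fcAQ.
have [c [[Ac nMc] Qc]] := meet _ Qo QI Q0; apply: nMc.
(* A basic [V] around [c] inside [Q] is one of the sets whose traces form [M], so [c] would lie in
   [M]. *)
have [V [BV Vc] VQ] := Bb c _ (open_nbhs_nbhs (conj Qo Qc)).
exists V; split=> //=; apply: first_category_subset fcAQ.
exact: setIS.
Qed.

(** * Countable base, Baire category and reflections on the real line *)

Lemma second_countable_real (R : realType) : @second_countable R.
Proof.
exists (range (fun qn : rat * nat => ball (ratr qn.1 : R) (qn.2.+1%:R^-1))).
  apply: sub_countable (card_image_le _ _) _; exact: countableP.
split=> [_ [[q n] _ <-]|x V]; first exact: ball_open.
move=> /nbhs_ballP[e /= e0 eV].
(* Half of [e], because a ball of radius [d] whose centre is within [d] of [x] reaches up to [2 * d]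
   away from [x]. *)
have [n ne] : exists n : nat, n.+1%:R^-1 < e / 2.
  have [n] := ltr_add_invr (divr_gt0 e0 (ltr0Sn R 1)).
  by rewrite add0r; exists n.
have n0 : 0 < n.+1%:R^-1 :> R by rewrite invr_gt0.
pose d : R := n.+1%:R^-1; rewrite -/d in ne n0.
have [q] : exists q : rat, ratr q \in `]x - d, x + d[.
  by apply: rat_in_itvoo; lra.
rewrite in_itv /= => /andP[xq qx].
exists (ball (ratr q : R) d).
  split; first by exists (q, n).
  by rewrite /= /ball /= ltr_norml; lra.
move=> y; rewrite /= /ball /= ltr_norml => qy.
by apply: eV; rewrite /ball /= ltr_norml; lra.
Qed.

(** By the Baire category theorem: the complements of the closures of the [F n] are open and dense,
    so a nonempty [U] has a point outside every [F n]. *)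
Lemma first_category_open_set0 (R : realType) (U : set R) :
  open U -> first_category U -> U = set0.
Proof.
move=> Uo [F ndF UE]; apply: contrapT => /eqP/set0P U0.
have [i|x [Ux]] := @Baire R R (fun n => ~` closure (F n)) _ U U0 Uo.
  split; first exact/closed_openC/closed_closure.
  move=> V [v Vv] Vo; apply: contrapT => VF.
  suff : (closure (F i))° v by rewrite ndF.
  apply: (filterS _ (open_nbhs_nbhs (conj Vo Vv))) => y Vy.
  by apply: contrapT => nF; apply: VF; exists y.
by move: Ux; rewrite UE => -[n _ Fx] /(_ n I); apply; exact: subset_closure.
Qed.

Lemma continuous_reflection (R : realType) (c : R) : continuous (fun x => c - x).
Proof. by move=> x; apply: cvgB; [exact: cvg_cst|exact: cvg_id]. Qed.

Lemma first_category_reflection (R : realType) (c : R) (A : set R) :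
  first_category A -> first_category ((fun x => c - x) @^-1` A).
Proof.
apply: first_category_preimage_involutive; first exact: continuous_reflection.
by move=> x; rewrite opprB addrC subrK.
Qed.

(** The conclusion is needed at all [x] near [a + b], so the conditions on [a] and [b] enter only
    through the set [V], which can be the same for all these [x]. *)
Lemma shift_continuous_locally_near (R : realType) (f : R -> R)
    (S T V : set R) (x e : R) :
  baire_function f -> shift_continuous S T f ->
  0 < e -> second_category (T `&` V) ->
  first_category [set t | V t /\ ~ S (x - t)] ->
  exists J : set R, [/\ open J, J x &
    first_category (J `&` [set y | e < `|f y - f x|])].
Proof.
move=> hf hST e0 scTV fcS; have [tau /= [[B cB [Bo Bb]] cf]] := hST.
pose A U := [set t | [/\ V t, S (x - t) & exists2 p : set_type T, set_val p = t /\ U p &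
  forall p' : set_type T, U p' -> `|f (x - t + set_val p') - f x| < e]].
have [U BU scU] : exists2 U, B U & second_category (A U).
  apply: contrapT => noU; apply: scTV.
  apply: (@first_category_subset _ _
    ([set t | V t /\ ~ S (x - t)] `|` \bigcup_(U in B) A U)).
    move=> t [Tt Vt]; have [St|nSt] := pselect (S (x - t)); last by left.
    right; pose p : set_type T := SigSub (mem_set Tt).
    have /= := cf _ St p _ (nbhsx_ballx _ _ e0).
    rewrite {1}/set_val /= => cft.
    have [U [BU Up] Ue] := Bb p _ cft.
    exists U => //; split=> //; exists p => // p' /Ue.
    by rewrite /= /ball /= subrK distrC.
  apply: first_categoryU => //; apply: first_category_bigcup => // U BU.
  by apply: contrapT => scU; apply: noU; exists U.
have [I [Io [t0 [[_ St0 [p0 [p0t Up0]] _]] It0] scI]] :=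
  second_category_localize _ _ (second_countable_real R) scU.
(* The reflection that swaps [t0] and [x]; as [t0] lies in [I], the preimage of [I] is a
   neighbourhood of [x]. *)
pose g y := x + t0 - y.
have gK : involutive g by move=> y; rewrite /g opprB addrC subrK.
have cg : continuous g by exact: continuous_reflection.
pose E := [set y | e < `|f y - f x|].
have [O Oo fcEO] : baire_set E.
  apply: (hf [set z | e < `|z - f x|]).
  apply: (@open_comp _ _ (fun z => `|z - f x|) [set z | e < z]) => [z _|].
    by apply: cvg_norm; apply: cvgB; [exact: cvg_id|exact: cvg_cst].
  exact: open_gt.
have Jo : open (g @^-1` I) by apply: open_comp.
exists (g @^-1` I); split=> //; first by rewrite /preimage /g /= addrC addKr.
(* If [y] were in [O], the reflection of [O] would meet [I] in a nonempty open set, whose trace on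
   [A U] is of second category. But [g] maps this trace into [O] minus [E], which is of first
   category. *)
apply: first_category_subset (fcEO) => y [Iy Ey]; left; split=> // Oy.
apply: (scI (I `&` g @^-1` O)).
- by apply: openI => //; apply: open_comp.
- by move=> z [].
- by exists (g y); split=> //=; rewrite gK.
apply: first_category_subset (first_category_reflection _ (x + t0) _ fcEO).
move=> t [[_ _ [p _ Up]] [_ Ogt]]; right; split=> //= Et.
(* Both [t] and [t0] belong to [A U], so the bound attached to [t] may be evaluated at [p0]. *)
have := Up _ Up0; rewrite p0t.
have -> : x - t + t0 = x + t0 - t by rewrite addrAC.
by move/(lt_trans Et); rewrite ltxx.
Qed.

Theorem theorem2 (R : realType) (f : R -> R) (hf : baire_function f)
  (S T : set R) (hS : baire_set S) (hST : shift_continuous S T f) :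
  forall x : R, sumset (BD S) (SC T) x -> {for x, continuous f}.
Proof.
move=> _ [a [U [Uo Ua fcUS]] [b SCb <-]].
have /nbhs_ballP[r /= r0 rU] : nbhs a U by exact: open_nbhs_nbhs.
have r20 : 0 < r / 2 by lra.
have near_good (x e : R) : 0 < e -> ball (a + b) (r / 2) x ->
    exists J : set R, [/\ open J, J x &
      first_category (J `&` [set y | e < `|f y - f x|])].
  move=> e0 xr; apply: (shift_continuous_locally_near _ _ S T (ball b (r / 2))) => //.
    apply: SCb; [exact: ball_open|exact: ballxx].
  (* The two radii [r / 2] add up to [r], so [x - t] is in [U], and the exceptional [t] reflect into
     [U] minus [S]. *)
  apply: first_category_subset (first_category_reflection _ x _ fcUS).
  move=> t [tr nSt]; split=> //=; apply: rU; move: tr xr.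
  by rewrite /ball /= !ltr_norml; lra.
apply/cvgrPdist_le => e e0.
have e20 : 0 < e / 2 by lra.
have [J [Jo Jab fcJ]] := near_good _ _ e20 (ballxx _ r20).
have near_ab : \forall y \near a + b, ball (a + b) (r / 2) y.
  exact: nbhsx_ballx.
have near_J : \forall y \near a + b, J y by exact: open_nbhs_nbhs.
near=> y.
have [|J' [J'o J'y fcJ']] := near_good y _ e20.
  by near: y; exact: near_ab.
have Jy : J y by near: y; exact: near_J.
(* If [f y] is further than [e] from [f (a + b)], no [f z] is within [e / 2] of both, so the open
   set [J] meets [J'] in a set of first category, which must be empty although it contains [y]. *)
apply: contrapT => fy; suff : (J `&` J') y.
  rewrite (first_category_open_set0 _ (J `&` J')) //; first exact: openI.
  apply: first_category_subset (first_categoryU _ _ _ fcJ fcJ').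
  move=> z [Jz J'z]; have [zab|zab] := ltP (e / 2) `|f z - f (a + b)|.
    by left.
  right; split=> //=; rewrite ltNge; apply/negP => zy; apply: fy.
  by move: zab zy; rewrite !ler_norml; lra.
by split.
Unshelve. all: by end_near.
Qed.
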